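(* Let $X$ be a topological space, let $\alpha:X\to X$ be a bijection such that $\alpha$ and $\alpha^{-1}$ are Borel measurable, and let $\mathcal F$ be a Banach function space on $X$ satisfying condition $\Omega_\alpha$. Let $w$ and $\frac1w$ be weight functions on $X$. Suppose that for each compact set $K\subseteq X$ there exist a sequence $(D_k)_{k=1}^\infty$ of Borel subsets of $K$ and a strictly increasing sequence $(n_k)\subset\mathbb N$ such that $\lim_{k\to\infty}\|\chi_{K\setminus D_k}\|_{\mathcal F}=0$ and $$\lim_{k\to\infty}\sum_{l=1}^{\infty}\left\|\chi_{D_k}\cdot\Big(\prod_{s=1}^{ln_k}w\circ\alpha^{-s}\Big)\right\|_{\mathcal F}=\lim_{k\to\infty}\sum_{l=1}^{\infty}\left\|\chi_{D_k}\cdot\Big(\prod_{s=0}^{ln_k-1}w\circ\alpha^{s}\Big)^{-1}\right\|_{\mathcal F}=0,$$ where the corresponding series are convergent for each $k$. Then the sequence $(C^{(n)}_{\alpha,w})_{n\in\mathbb N_0}$ is chaotic on $\mathcal F$.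
   Context: Notation: $\mathbb N_0=\mathbb N\cup\{0\}$; $\mathcal M_0(X)$ is the set of all Borel measurable complex-valued functions on $X$; $\chi_A$ is the characteristic function of $A$; $\alpha^s$ is the $s$-fold composition of $\alpha$ (and $\alpha^{-s}$ that of $\alpha^{-1}$). Banach function space on $X$: a linear subspace $\mathcal F$ of $\mathcal M_0(X)$ equipped with a norm $\|\cdot\|_{\mathcal F}$ making it a Banach space. Standing assumption: $\mathcal F$ is separable and infinite-dimensional. Solid: if $f\in\mathcal F$, $g\in\mathcal M_0(X)$ and $|g|\le|f|$, then $g\in\mathcal F$ and $\|g\|_{\mathcal F}\le\|f\|_{\mathcal F}$. $\alpha$-invariant: for each $f\in\mathcal F$, $f\circ\alpha^{\pm1}\in\mathcal F$ and $\|f\circ\alpha^{\pm1}\|_{\mathcal F}=\|f\|_{\mathcal F}$. Condition $\Omega_\alpha$: (1) $\mathcal F$ is solid and $\alpha$-invariant; (2) $\chi_E\in\mathcal F$ for each compact $E\subseteq X$; (3) the set $\mathcal F_{bc}$ of all bounded compactly supported functions in $\mathcal F$ is dense in $\mathcal F$. Weight: a bounded Borel measurable function $w:X\to(0,\infty)$. For weights $w,\frac1w$, define $T_{\alpha,w}f:=w\cdot(f\circ\alpha)$ for $f\in\mathcal F$; this is a bounded invertible operator on $\mathcal F$, with inverse $S_{\alpha,w}f=\frac{f\circ\alpha^{-1}}{w\circ\alpha^{-1}}$. Put $C^{(n)}_{\alpha,w}:=\frac12(T^n_{\alpha,w}+S^n_{\alpha,w})$. A sequence $(T_n)_{n\in\mathbb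 N_0}$ of bounded linear operators on a Banach space $\mathcal X$ is topologically transitive if for all non-empty open $U,V\subseteq\mathcal X$ there is $n\in\mathbb N$ with $T_n(U)\cap V\ne\varnothing$. A vector $x\in\mathcal X$ is a periodic element of $(T_n)$ if there is $N\in\mathbb N$ with $T_{kN}x=x$ for all $k\in\mathbb N$; $\mathcal P((T_n)_{n\in\mathbb N_0})$ is the set of periodic elements. The sequence is chaotic if it is topologically transitive and $\mathcal P((T_n)_{n\in\mathbb N_0})$ is dense in $\mathcal X$. *)

(* Defs.v *)
From HB Require Import structures.
From mathcomp Require Import all_boot all_order all_algebra.
From mathcomp Require Import all_classical all_reals all_analysis.
From mathcomp Require Import complex.

Set Implicit Arguments.
Unset Strict Implicit.
Unset Printing Implicit Defensive.

Import Order.TTheory GRing.Theory Num.Theory.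
Import numFieldNormedType.Exports.

Local Open Scope classical_set_scope.
Local Open Scope complex_scope.
Local Open Scope ring_scope.

(* [measurable_fun] would require pointed spaces, hence the direct use of the
   generated sigma-algebra. *)
Definition borel (T : topologicalType) (A : set T) : Prop := <<s open >> A.

Definition borel_measurable (T U : topologicalType) (f : T -> U) : Prop :=
  forall B : set U, borel B -> borel (f @^-1` B).

Definition separable (T : topologicalType) : Prop :=
  exists2 D : set T, countable D & dense D.

Definition finite_dimensional (K : numFieldType) (V : lmodType K) : Prop :=
  exists s : seq V, forall v : V, exists c : 'I_(size s) -> K,
    v = \sum_i c i *: s`_i.

(* The linear subspace of M_0(X) is the range of [bfs_fun], and its Banach
   space structure is carried by [bfs_sort]. *)
Record banach_function_space (R : realType) (X : topologicalType) := BFS {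
  bfs_sort :> completeNormedModType R[i];
  bfs_fun : {linear bfs_sort -> (X -> R[i]^o)};
  bfs_fun_inj : injective bfs_fun;
  bfs_fun_measurable : forall f, borel_measurable (bfs_fun f);
  bfs_separable : separable bfs_sort;
  bfs_infinite_dimensional : ~ finite_dimensional bfs_sort }.
Arguments bfs_fun {R X b}.

Section BanachFunctionSpace.
Context {R : realType} {X : topologicalType} (F : banach_function_space R X).
Implicit Types (h : X -> R[i]) (a ainv : X -> X) (w : X -> R).

Definition in_bfs h : Prop := exists f : F, bfs_fun f = h.

(* The norm of F extended by +oo = ereal_inf set0 to functions outside F; the
   norm of the library takes its values in R[i], hence the real part. *)
Definition fnorm h : \bar R :=
  ereal_inf [set (complex.Re `|f|)%:E | f in [set f : F | bfs_fun f = h]].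

Definition solid : Prop :=
  forall (f : F) (g : X -> R[i]^o), borel_measurable g ->
    (forall x, `|g x| <= `|bfs_fun f x|) ->
    exists2 g' : F, bfs_fun g' = g & `|g'| <= `|f|.

Definition comp_invariant a : Prop :=
  forall f : F, exists2 g : F, bfs_fun g = bfs_fun f \o a & `|g| = `|f|.

Definition bounded_compact_support : set F :=
  [set f | (exists M : R, forall x, `|bfs_fun f x| <= M%:C) /\
           compact (closure [set x | bfs_fun f x != 0])].

Definition condition_Omega a ainv : Prop :=
  [/\ solid, comp_invariant a, comp_invariant ainv,
      forall E : set X, compact E -> in_bfs \1_E
    & dense bounded_compact_support].

(* The element of F whose function is x |-> w x * f (a x); [bfs_fun] being
   injective, there is at most one, and the default 0 is irrelevant as soon as
   F is solid and a-invariant and w is a weight. *)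
Definition weighted_comp a w (f : F) : F :=
  xget 0 [set g : F | forall x, bfs_fun g x = (w x)%:C * bfs_fun f (a x)].

Definition T_op a w : F -> F := weighted_comp a w.

Definition S_op ainv w : F -> F :=
  weighted_comp ainv (fun x => (w (ainv x))^-1).

Definition C_op a ainv w (n : nat) (f : F) : F :=
  2^-1 *: (iter n (T_op a w) f + iter n (S_op ainv w) f).

End BanachFunctionSpace.
Arguments C_op {R X} F a ainv w n f.

Definition weight (R : realType) (X : topologicalType) (w : X -> R) : Prop :=
  [/\ borel_measurable w, forall x, 0 < w x & exists M, forall x, w x <= M].

Section LinearDynamics.
Context {V : topologicalType} (T : nat -> V -> V).

Definition topologically_transitive : Prop :=
  forall U W : set V, open U -> open W -> U !=set0 -> W !=set0 ->
    exists n, (0 < n)%N /\ (T n @` U) `&` W !=set0.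

Definition periodic_elements : set V :=
  [set x | exists N, (0 < N)%N /\ forall k, (0 < k)%N -> T (k * N) x = x].

Definition chaotic : Prop :=
  topologically_transitive /\ dense periodic_elements.

End LinearDynamics.

(* Main.v *)
(* Cut a bounded function f supported in a compact K down to f' := f 1_D with
   D = D_k and n = n_k. Composing T^m f' with the norm-preserving alpha^-m shows
   that |T^(ln) f'| is at most a constant times the l-th term of the first
   series, and similarly for S and the second series. So for large k, f' is
   close to f and the sums over l >= 1 of |T^(ln) f'| and |S^(ln) f'| are small.
   Then p := f' + sum_l T^(ln) f' + sum_l S^(ln) f' is close to f and T^n p = p,
   which gives density of periodic elements; and v := f' + 2 T^n g' is close
   to f while C^(n) v is close to g, which gives transitivity. *)

Require Import Defs.
From mathcomp Require Import all_boot all_order all_algebra.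
From mathcomp Require Import all_classical all_reals all_analysis.
From mathcomp Require Import complex.
From mathcomp Require Import lra.

Set Implicit Arguments.
Unset Strict Implicit.
Unset Printing Implicit Defensive.

Import Order.TTheory GRing.Theory Num.Theory.
Import numFieldNormedType.Exports.

Local Open Scope classical_set_scope.
Local Open Scope complex_scope.
Local Open Scope ring_scope.

(** * Borel measurability and second countability of the complex plane *)

Lemma borel_bigcup (X : topologicalType) (I : Type) (D : set I) (A : I -> set X) :
  countable D -> (forall i, D i -> borel (A i)) -> borel (\bigcup_(i in D) A i).
Proof.
case/pfcard_geP=> [-> _|[e] mA]; first by rewrite bigcup_set0; exact: sigma_algebra0.
have -> : D = range e by rewrite image_eq.
by rewrite bigcup_image; apply: sigma_algebra_bigcup => n; apply: mA; exact: funS.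
Qed.

Lemma borelC (X : topologicalType) (A : set X) : borel A -> borel (~` A).
Proof. by move=> mA; rewrite -setTD; exact: sigma_algebraCD. Qed.

Lemma borelU (X : topologicalType) (A B : set X) :
  borel A -> borel B -> borel (A `|` B).
Proof.
move=> mA mB; rewrite -(bigcup2E A B); apply: sigma_algebra_bigcup => -[|[|i]] //=.
exact: sigma_algebra0.
Qed.

Lemma borelI (X : topologicalType) (A B : set X) :
  borel A -> borel B -> borel (A `&` B).
Proof.
by move=> mA mB; rewrite -[_ `&` _]setCK setCI; apply: borelC; apply: borelU; exact: borelC.
Qed.

(** The sets with Borel preimage form a sigma-algebra, so testing generators suffices. *)
Lemma borel_measurable_open (X Y : topologicalType) (f : X -> Y) :
  (forall U, open U -> borel (f @^-1` U)) -> borel_measurable f.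
Proof.
move=> fU B; apply: (@smallest_sub _ _ _ [set B | borel (f @^-1` B)]) => //.
split=> /= [|A mA|A mA].
- by rewrite preimage_set0; exact: sigma_algebra0.
- by rewrite setTD preimage_setC; exact: borelC.
- by rewrite preimage_bigcup; exact: sigma_algebra_bigcup.
Qed.

Lemma borel_measurable_comp (X Y Z : topologicalType) (g : Y -> Z) (f : X -> Y) :
  borel_measurable g -> borel_measurable f -> borel_measurable (g \o f).
Proof. by move=> mg mf B /mg /mf. Qed.

(** An open preimage under [op] is a union of rectangles with basic open sides; second countability
    makes that union countable. *)
Lemma borel_measurable_op2 (X Y Z W : topologicalType) (op : Y * Z -> W)
    (f : X -> Y) (g : X -> Z) :
  @second_countable Y -> @second_countable Z -> continuous op ->
  borel_measurable f -> borel_measurable g ->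
  borel_measurable (fun x => op (f x, g x)).
Proof.
move=> [BY cBY [oBY bBY]] [BZ cBZ [oBZ bBZ]] cop mf mg.
apply: borel_measurable_open => U oU.
pose I := [set UV | (BY `*` BZ) UV /\ UV.1 `*` UV.2 `<=` op @^-1` U].
have -> : (fun x => op (f x, g x)) @^-1` U =
    \bigcup_(UV in I) (f @^-1` UV.1 `&` g @^-1` UV.2).
  apply/seteqP; split=> [x Ux|x [[P Q] [_ /= PQU] [/= Px Qx]]]; last exact: PQU.
  have /cop [[P Q] /= [/bBY[P' [BP' P'x] P'P] /bBZ[Q' [BQ' Q'x] Q'Q]] PQU] :
    nbhs (op (f x, g x)) U by exact: open_nbhs_nbhs.
  exists (P', Q') => //; split => // -[y z] [/= P'y Q'z].
  by apply: PQU; split; [exact: P'P|exact: Q'Q].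
apply: borel_bigcup => [|UV [[BU BV] _]].
  by apply: sub_countable (countableX cBY cBZ); apply: subset_card_le => UV [].
by apply: borelI; [apply: mf|apply: mg]; apply: sub_sigma_algebra; [exact: oBY|exact: oBZ].
Qed.

(** The base consists of interiors of balls of radius [r n] about points of a countable dense set.
    The radii [r] are a parameter because [K] is not assumed archimedean. *)
Lemma second_countable_pseudometric (K : numFieldType) (M : pseudoMetricType K)
    (r : nat -> K) :
  (forall n, 0 < r n) -> (forall e : K, 0 < e -> exists n, r n <= e) ->
  Defs.separable M -> @second_countable M.
Proof.
move=> r_gt0 r_small [D cD dD].
exists ((fun p : M * nat => (ball p.1 (r p.2))^°) @` (D `*` setT)).
  by apply: sub_countable (card_image_le _ _) (countableX cD _).
split=> [_ [p _ <-]|x U]; first exact: open_interior.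
case/nbhs_ballP=> e /= e0 eU.
have e2 : 0 < e / 2 by rewrite divr_gt0.
have [n rn] := r_small _ e2.
have rn2 : 0 < r n / 2 by rewrite divr_gt0.
(* Taking [d] within half the radius makes [x] interior to [ball d (r n)], while [r n <= e / 2]
   keeps that ball inside [ball x e]. *)
have [||d [xd Dd]] := dD (ball x (r n / 2))^°; [|exact: open_interior|].
  by exists x; exact: nbhsx_ballx.
have {}xd := interior_subset xd.
exists (ball d (r n))^°; first split.
- by exists (d, n).
- apply/nbhs_ballP; exists (r n / 2) => //= y xy.
  by rewrite (splitr (r n)); apply: ball_triangle xy; exact: ball_sym.
- move=> y /interior_subset dy; apply: eU.
  rewrite (splitr e); apply: (@ball_triangle _ _ d).
    by apply: le_ball xd; apply: le_trans rn; rewrite ler_pdivrMr// ler_peMr// ?ler1n// ltW.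
  exact: le_ball dy.
Qed.

Lemma normc_real (R : rcfType) (c : R) : `|c%:C| = `|c|%:C.
Proof. by rewrite normc_def /= expr0n addr0 sqrtr_sqr. Qed.

Lemma normc_le_ReIm (R : realType) (a b : R) :
  `|a +i* b| <= (`|a| + `|b|)%:C.
Proof.
rewrite normc_def lecR /= -[leRHS]ger0_norm ?addr_ge0// -sqrtr_sqr ler_sqrt ?sqr_ge0//.
by rewrite sqrrD !real_normK ?num_real// lerD2r lerDl mulrn_wge0 ?mulr_ge0.
Qed.

Lemma separable_complex (R : realType) : Defs.separable R[i]^o.
Proof.
exists (range (fun p : rat * rat => (ratr p.1 +i* ratr p.2 : R[i]^o))).
  exact: sub_countable (card_image_le _ _) _.
move=> O [z Oz] oO.
have /nbhs_ballP[e /= e0 eO] := open_nbhs_nbhs (conj oO Oz).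
(* In the order of [R[i]], a positive element has zero imaginary part, so the radius is real. *)
case: e e0 eO => e e' /=; rewrite ltcE /= => /andP[/eqP -> e0] eO.
have e2 : 0 < e / 2 by rewrite divr_gt0.
have near_rat (a : R) : exists q : rat, `|a - ratr q| < e / 2.
  have ne : ball a (e / 2) !=set0 by exists a; exact: ballxx.
  have [y [/= aq [q _ def_q]]] := dense_rat ne (ball_open _ _).
  by exists q; rewrite def_q.
have [[p hp] [q hq]] := (near_rat (complex.Re z), near_rat (complex.Im z)).
exists (ratr p +i* ratr q); split; last by exists (p, q).
apply: eO => /=; case: z hp hq {Oz} => a b /= hp hq.
apply: le_lt_trans (normc_le_ReIm _ _) _.
by rewrite ltcR (splitr e) ltrD.
Qed.

Lemma second_countable_complex (R : realType) : @second_countable R[i]^o.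
Proof.
apply: (@second_countable_pseudometric _ _ (fun n => (n.+1%:R^-1)%:C)) => [n|e e0|].
- by rewrite ltcR invr_gt0.
- case: e e0 => e e' /=; rewrite ltcE /= => /andP[/eqP -> e0].
  have [n _ ne] := near_infty_natSinv_lt (PosNum e0).
  by exists n; rewrite lecR; apply/ltW/(ne n) => /=.
- exact: separable_complex.
Qed.

Lemma continuous_real_complex (R : realType) :
  continuous (fun x : R => x%:C : R[i]^o).
Proof.
move=> x; apply/cvgrPdist_lt => -[e e'] /=; rewrite ltcE /= => /andP[/eqP -> e0].
near=> y; rewrite -rmorphB normc_real ltcR.
by near: y; exact: cvgr_dist_lt.
Unshelve. all: by end_near. Qed.

Lemma continuous_borel_measurable (X Y : topologicalType) (f : X -> Y) :
  continuous f -> borel_measurable f.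
Proof.
move=> cf; apply: borel_measurable_open => U oU.
by apply: sub_sigma_algebra; move/continuousP : cf; exact.
Qed.

Lemma borel_measurable_realM (R : realType) (X : topologicalType)
    (u : X -> R) (h : X -> R[i]^o) :
  borel_measurable u -> borel_measurable h ->
  borel_measurable (fun x => (u x)%:C * h x : R[i]^o).
Proof.
move=> mu mh; pose op (p : R[i]^o * R[i]^o) : R[i]^o := p.1 * p.2.
apply: (@borel_measurable_op2 _ _ _ _ op (fun x => (u x)%:C)) => //.
- exact: second_countable_complex.
- exact: second_countable_complex.
- exact: mul_continuous.
- apply: (@borel_measurable_comp _ _ _ (fun x : R => x%:C : R[i]^o)) mu.
  by apply: continuous_borel_measurable; exact: continuous_real_complex.
Qed.

(** * Real-valued norm and absolutely convergent series *)

Section RealNorm.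
Context {R : realType} {V : completeNormedModType R[i]}.
Implicit Types (f g : V) (e B C : R).

(** The norm takes values in [R[i]]; its real part loses nothing ([nrmE]) and lives in the totally
    ordered [R], where monotone convergence applies. *)
Definition nrm f : R := complex.Re `|f|.

Lemma nrmE f : `|f| = (nrm f)%:C.
Proof. by rewrite /nrm RRe_real// normr_real. Qed.

Lemma nrm_ge0 f : 0 <= nrm f.
Proof. by rewrite -lecR -nrmE normr_ge0. Qed.

Lemma nrm0 : nrm 0 = 0.
Proof. by rewrite /nrm normr0. Qed.

Lemma nrm0_eq0 f : nrm f = 0 -> f = 0.
Proof. by move=> f0; apply/eqP; rewrite -normr_eq0 nrmE f0. Qed.

Lemma nrmN f : nrm (- f) = nrm f.
Proof. by rewrite /nrm normrN. Qed.

Lemma nrmD f g : nrm (f + g) <= nrm f + nrm g.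
Proof. by rewrite -lecR rmorphD /= -!nrmE ler_normD. Qed.

Lemma nrm_distC f g : nrm (f - g) = nrm (g - f).
Proof. by rewrite -nrmN opprB. Qed.

Lemma nrm_dist_trans g f h : nrm (f - h) <= nrm (f - g) + nrm (g - h).
Proof. by apply: le_trans (nrmD _ _); rewrite addrA subrK. Qed.

Lemma nrmZ (c : R) f : nrm (c%:C *: f) = `|c| * nrm f.
Proof.
have := normrZ c%:C f; rewrite nrmE normc_real nrmE -rmorphM.
by move/complexI.
Qed.

Lemma ler_nrm_sum (I : Type) (s : seq I) (P : pred I) (u : I -> V) :
  nrm (\sum_(i <- s | P i) u i) <= \sum_(i <- s | P i) nrm (u i).
Proof.
elim/big_ind2: _ => [|x1 x2 y1 y2 h1 h2|//]; first by rewrite nrm0.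
exact: le_trans (nrmD _ _) (lerD h1 h2).
Qed.

Lemma open_nrm_ball (U : set V) f : open U -> U f ->
  exists2 e, 0 < e & forall g, nrm (f - g) < e -> U g.
Proof.
move=> oU Uf; have /nbhs_ballP[[e e'] /=] := open_nbhs_nbhs (conj oU Uf).
rewrite ltcE /= => /andP[/eqP -> e0] eU; exists e => // g fg.
by apply: eU; rewrite -ball_normE /= nrmE ltcR.
Qed.

(** The partial sums of norms are nondecreasing and bounded, hence convergent; their increments
    dominate those of the partial sums of [u], and [V] is complete. *)
Lemma summable_nrm_cvg (u : nat -> V) B :
  (forall m, \sum_(0 <= l < m) nrm (u l) <= B) ->
  exists2 A, nrm A <= B & forall e, 0 < e ->
    exists N, forall m, (N <= m)%N -> nrm (A - \sum_(0 <= l < m) u l) < e.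
Proof.
move=> uB; pose s m := \sum_(0 <= l < m) nrm (u l).
pose S m := \sum_(0 <= l < m) u l.
have snd : nondecreasing_seq s.
  apply/nondecreasing_seqP => m.
  by rewrite /s [leRHS]big_nat_recr//= lerDl nrm_ge0.
have s_cvg : cvgn s.
  by apply: nondecreasing_is_cvgn => //; exists B => _ [m _ <-]; exact: uB.
have S_dist m n : (m <= n)%N -> nrm (S m - S n) <= s n - s m.
  move=> mn; rewrite nrm_distC /S /s !(big_cat_nat (leq0n m) mn) /=.
  by rewrite [X in nrm X]addrAC subrr add0r [leRHS]addrAC subrr add0r ler_nrm_sum.
have S_cvg : cvgn S.
  apply/cauchy_cvgP/cauchy_exP => -[e e'] /=; rewrite ltcE /= => /andP[/eqP -> e0].
  have [N _ sN] := cvgr_dist_lt _ _ s_cvg _ e0.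
  exists (S N), N => // n /= Nn; rewrite -ball_normE /= nrmE ltcR.
  apply: le_lt_trans (S_dist _ _ Nn) _; apply: le_lt_trans (sN _ (leqnn N)).
  by apply: le_trans (ler_norm _); rewrite lerD2r nondecreasing_cvgn_le.
have S_lim e : 0 < e ->
    exists N, forall m, (N <= m)%N -> nrm (limn S - S m) < e.
  move=> e0; have ec0 : 0 < e%:C by rewrite ltcR.
  have [N _ SN] := cvgr_dist_lt _ _ S_cvg _ ec0.
  by exists N => m Nm; have := SN m Nm; rewrite /= nrmE ltcR.
exists (limn S) => //; apply/ler_addgt0Pr => e /S_lim[N SN].
rewrite -[limn S](subrK (S N)) addrC; apply: le_trans (nrmD _ _) _.
rewrite lerD ?(ltW (SN _ (leqnn N)))//.
exact: le_trans (ler_nrm_sum _ _ _) (uB N).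
Qed.

Lemma nrm_lt_eq (f g : V) : (forall e, 0 < e -> nrm (f - g) < e) -> f = g.
Proof.
move=> fg; apply/subr0_eq/nrm0_eq0/eqP; rewrite eq_le nrm_ge0 andbT.
by apply/ler_addgt0Pr => e /fg /ltW; rewrite add0r.
Qed.

(** [A] is the sum of [iter l L u] over [l >= 1]. Applying [L] drops its first term; the bound on
    [L] carries this from partial sums to the limit. *)
Lemma sum_iter_fixed (L : V -> V) C u B :
  {morph L : f g / f + g} -> (forall f, nrm (L f) <= C * nrm f) ->
  (forall m, \sum_(0 <= l < m) nrm (iter l.+1 L u) <= B) ->
  exists2 A, nrm A <= B & L A = A - L u.
Proof.
move=> LD LC uB; have [A AB A_lim] := summable_nrm_cvg uB.
exists A => //; pose s m := \sum_(0 <= l < m) iter l.+1 L u.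
have L0 : L 0 = 0 by apply: (addIr (L 0)); rewrite -LD !add0r.
have LB f g : L (f - g) = L f - L g by apply: (addIr (L g)); rewrite -LD !subrK.
have Ls m : L (s m) = s m.+1 - L u.
  rewrite /s (big_morph L LD L0) [in RHS]big_nat_recl//=.
  by rewrite addrAC subrr add0r.
(* [C] may be zero or negative, and the error is divided by it below. *)
pose C' := Num.max C 1.
have C'0 : 0 < C' by rewrite lt_max ltr01 orbT.
apply: nrm_lt_eq => e e0.
have e2 : 0 < e / 2 by rewrite divr_gt0.
have [N1 sN1] := A_lim _ (divr_gt0 e2 C'0).
have [N2 sN2] := A_lim _ e2.
pose m := maxn N1 N2.
have h1 := sN1 m (leq_maxl _ _).
have h2 := sN2 m.+1 (leqW (leq_maxr _ _)).
rewrite (splitr e).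
apply: le_lt_trans (nrm_dist_trans (L (s m)) _ _) _; apply: ltrD.
  rewrite -LB; apply: le_lt_trans (LC _) _.
  apply: le_lt_trans (ler_wpM2r (nrm_ge0 _) (_ : C <= C')) _.
    by rewrite le_max lexx.
  by rewrite mulrC -ltr_pdivlMr.
by rewrite Ls nrm_distC opprB addrA subrK.
Qed.

End RealNorm.

(** * Chaos of the cosine sequence of an invertible operator *)

Lemma iter_morphD (V : zmodType) (L : V -> V) n :
  {morph L : f g / f + g} -> {morph iter n L : f g / f + g}.
Proof. by move=> LD f g; elim: n => //= n ->. Qed.

Section CosineChaos.
Context {R : realType} {V : completeNormedModType R[i]}.
Context (T S : V -> V) (CT CS : R).
Context (TD : {morph T : f g / f + g}) (SD : {morph S : f g / f + g}).
Context (CT0 : 0 <= CT) (CS0 : 0 <= CS).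
Context (T_bound : forall f, nrm (T f) <= CT * nrm f)
  (S_bound : forall f, nrm (S f) <= CS * nrm f).
Context (TK : cancel T S) (SK : cancel S T).
Implicit Types (f g h : V) (e : R).

Lemma iter_nrm_bound (L : V -> V) (C : R) n f : 0 <= C ->
  (forall f, nrm (L f) <= C * nrm f) -> nrm (iter n L f) <= C ^+ n * nrm f.
Proof.
move=> C0 LC; elim: n => [|n IH] /=; first by rewrite mul1r.
by apply: le_trans (LC _) _; rewrite exprS -mulrA ler_wpM2l.
Qed.

(** The orbits start at the power [n], leaving out [h] itself. Bounding all partial sums gives both
    convergence of the series and the size of its sum. *)
Definition orbit_sums_le (n : nat) e h :=
  (forall m, \sum_(0 <= l < m) nrm (iter (l.+1 * n) T h) <= e) /\
  (forall m, \sum_(0 <= l < m) nrm (iter (l.+1 * n) S h) <= e).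

Context (D : set V).
Context (dense_D : dense D).
(** One [n] serves both vectors, since transitivity applies a single operator to a vector built from
    both approximants. *)
Context (D_approx : forall f g, D f -> D g -> forall e, 0 < e ->
  exists2 n, (0 < n)%N & exists f' g',
    [/\ nrm (f - f') <= e, nrm (g - g') <= e,
        orbit_sums_le n e f' & orbit_sums_le n e g']).

Let cosine n f := 2^-1 *: (iter n T f + iter n S f).

Let iterK n : cancel (iter n T) (iter n S).
Proof. by elim: n => // n IH f; rewrite iterSr iterS TK IH. Qed.

Let iterKV n : cancel (iter n S) (iter n T).
Proof. by elim: n => // n IH f; rewrite iterSr iterS SK IH. Qed.

Let half2 f : 2^-1 *: (f + f) = f.
Proof. by rewrite -mulr2n -[f *+ 2]scaler_nat scalerA mulVf ?scale1r// pnatr_eq0. Qed.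

Let nrm_half f : nrm (2^-1 *: f) = 2^-1 * nrm f.
Proof.
by rewrite -[X in X *: _]/((2%:R)^-1) -(rmorph_nat (real_complex R)) -fmorphV nrmZ
  ger0_norm ?invr_ge0.
Qed.

Lemma cosine_transitive : topologically_transitive cosine.
Proof.
move=> U W oU oW U0 W0.
have [f [Uf Df]] := dense_D U0 oU.
have [g [Wg Dg]] := dense_D W0 oW.
have [eU eU0 UP] := open_nrm_ball oU Uf.
have [eW eW0 WP] := open_nrm_ball oW Wg.
(* Each of the two distances estimated below is a sum of three errors at most [e]; the fourth share
   makes the inequality strict. *)
pose e := Num.min eU eW / 4.
have e0 : 0 < e by rewrite divr_gt0// lt_min eU0.
have e3U : e + (e + e) < eU.
  have : Num.min eU eW <= eU by rewrite ge_min lexx.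
  by move: e0; rewrite /e; lra.
have e3W : e + (e + e) < eW.
  have : Num.min eU eW <= eW by rewrite ge_min lexx orbT.
  by move: e0; rewrite /e; lra.
have [n n0 [f' [g' [ff' gg' [Tf' Sf'] [Tg' Sg']]]]] := D_approx Df Dg e0.
have {}Tf' : nrm (iter n T f') <= e by have := Tf' 1; rewrite big_nat1 mul1n.
have {}Sf' : nrm (iter n S f') <= e by have := Sf' 1; rewrite big_nat1 mul1n.
have Tg1 : nrm (iter n T g') <= e by have := Tg' 1; rewrite big_nat1 mul1n.
(* This is the second orbit term, produced when [iter n T] hits the [iter n T g'] inside [v]. *)
have Tg2 : nrm (iter n T (iter n T g')) <= e.
  have := Tg' 2; rewrite big_nat_recr//= big_nat1 mul1n mul2n -addnn iterD.
  by apply: le_trans; rewrite lerDr nrm_ge0.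
(* The doubling offsets the factor 1/2: the [S] half returns [g'], and what remains is T^(2n) g'
   plus half of T^n f' + S^n f', all small. *)
exists n; split => //; pose v := f' + (iter n T g' + iter n T g').
exists (cosine n v); split.
  exists v => //; apply: UP.
  rewrite opprD addrA; apply: le_lt_trans (nrmD _ _) _; rewrite nrmN.
  apply: le_lt_trans e3U; rewrite lerD//.
  by apply: le_trans (nrmD _ _) _; rewrite lerD.
apply: WP; rewrite /cosine /v !(iter_morphD _ TD, iter_morphD _ SD) !iterK.
rewrite addrACA scalerDr [X in _ + _ *: X]addrACA half2.
rewrite [_ + g']addrC addrCA opprD addrA.
apply: le_lt_trans (nrmD _ _) _; rewrite nrmN; apply: le_lt_trans e3W.
rewrite lerD//; apply: le_trans (nrmD _ _) _; rewrite lerD//.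
rewrite nrm_half mulrC ler_pdivrMr// mulr_natr mulr2n.
by apply: le_trans (nrmD _ _) _; rewrite lerD.
Qed.

Lemma cosine_dense_periodic : dense (periodic_elements cosine).
Proof.
move=> U U0 oU; have [f [Uf Df]] := dense_D U0 oU.
have [eU eU0 UP] := open_nrm_ball oU Uf.
pose e := eU / 4; have e0 : 0 < e by rewrite divr_gt0.
have [n n0 [f' [_ [ff' _ [Tf' Sf'] _]]]] := D_approx Df Df e0.
have [h|m|A Ae TA] := @sum_iter_fixed _ _ (iter n T) (CT ^+ n) f' e (iter_morphD _ TD).
- exact: iter_nrm_bound.
- by move: (Tf' m); under eq_bigr do rewrite iterM.
have [h|m|B Be SB] := @sum_iter_fixed _ _ (iter n S) (CS ^+ n) f' e (iter_morphD _ SD).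
- exact: iter_nrm_bound.
- by move: (Sf' m); under eq_bigr do rewrite iterM.
pose p := f' + A + B.
(* [p] sums T^(ln) f' over all integers l, and T^n shifts this sum onto itself: [f'] moves into the
   [A] part and a new [f'] comes out of [B]. *)
have Tp : iter n T p = p.
  (* [SB] says that B = S^n B + S^n f'; apply T^n to this. *)
  have TB : iter n T B = B + f'.
    rewrite -[in LHS](subrK (iter n S f') B) -SB (iter_morphD _ TD).
    by rewrite !iterKV.
  by rewrite !(iter_morphD _ TD) TA TB [iter n T f' + _]addrCA subrr addr0 addrA addrC addrA.
have Sp : iter n S p = p by rewrite -{1}Tp iterK.
exists p; split.
  apply: UP; rewrite /p !opprD !addrA.
  apply: le_lt_trans (nrmD _ _) _; rewrite nrmN.
  apply: (@le_lt_trans _ _ (e + e + e)).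
    rewrite lerD//; apply: le_trans (nrmD _ _) _; rewrite nrmN lerD//.
  by rewrite /e -!mulr2n; lra.
exists n; split=> // k _; rewrite /cosine !iterM.
have fix_iter (L : V -> V) : L p = p -> iter k L p = p by move=> Lp; elim: k => //= k ->.
by rewrite !fix_iter// half2.
Qed.

End CosineChaos.

(** * Weighted composition operators on solid invariant spaces *)

Section WeightedComposition.
Context {R : realType} {X : topologicalType} {F : banach_function_space R X}.
Implicit Types (f g : F) (a b : X -> X) (v : X -> R) (M : R).

Lemma solid_nrm f g : solid F ->
  (forall x, `|bfs_fun g x| <= `|bfs_fun f x|) -> nrm g <= nrm f.
Proof.
move=> sF gf; have [g' g'g] := sF f _ (bfs_fun_measurable g) gf.
by rewrite (bfs_fun_inj g'g) !nrmE lecR.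
Qed.

Lemma fnorm_ge0 h : (0 <= fnorm F h)%E.
Proof. by apply: le_ereal_inf_tmp => _ [f _ <-]; rewrite lee_fin nrm_ge0. Qed.

(** Solidity compares [g] with [M] times each representative of [h]; when [h] is outside [F] there
    is none and the right-hand side is infinite. *)
Lemma solid_fnorm M g (h : X -> R[i]) : solid F -> 0 < M ->
  (forall x, `|bfs_fun g x| <= M%:C * `|h x|) ->
  ((nrm g)%:E <= M%:E * fnorm F h)%E.
Proof.
move=> sF M0 gh; rewrite -lee_pdivrMl//; apply: le_ereal_inf_tmp => _ [f fh <-].
rewrite -EFinM lee_fin ler_pdivrMl// -(ger0_norm (ltW M0)) -nrmZ.
apply: solid_nrm sF _ => x; rewrite linearZ /= fh.
by rewrite normrM normc_real (ger0_norm (ltW M0)).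
Qed.

(** Solidity below [M] times the composite of [f] with [a] puts the weighted function in [F], so
    [xget] never returns its default. *)
Lemma weighted_compP a v f : solid F -> comp_invariant F a ->
  borel_measurable a -> weight v -> forall M, (forall x, v x <= M) ->
  (forall x, bfs_fun (weighted_comp a v f) x = (v x)%:C * bfs_fun f (a x)) /\
  nrm (weighted_comp a v f) <= M * nrm f.
Proof.
move=> sF aF ma [mv v0 _] M vM.
have [g0 g0E g0f] := aF f.
have [||g gE gg0] := sF (M%:C *: g0) (fun x => (v x)%:C * bfs_fun f (a x)).
- apply: borel_measurable_realM => //.
  exact: borel_measurable_comp (bfs_fun_measurable f) ma.
- move=> x; rewrite linearZ /= g0E !normrM ler_wpM2r//.
  have vx0 := ltW (v0 x); have M0 := le_trans vx0 (vM x).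
  by rewrite !normc_real lecR !ger0_norm.
have WE : weighted_comp a v f = g.
  rewrite /weighted_comp; case: xgetP => [y _ yE|/(_ g) []]; last by move=> x; rewrite gE.
  by apply: bfs_fun_inj; rewrite gE; apply/funext => x; rewrite yE.
rewrite WE; split=> [x|]; first by rewrite gE.
(* A negative [M] forces [X] to be empty, and then [F] is zero. *)
have [M0|M0] := leP 0 M.
  by move: gg0; rewrite !nrmE lecR nrmZ (ger0_norm M0) /nrm g0f.
have noX (x : X) : False.
  by have := le_lt_trans (vM x) M0; rewrite ltNge (ltW (v0 x)).
have F0 (h : F) : h = 0 by apply: bfs_fun_inj; apply/funext => x; case: (noX x).
by rewrite (F0 g) (F0 f) nrm0 mulr0.
Qed.

Lemma weighted_compD a v : solid F -> comp_invariant F a ->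
  borel_measurable a -> weight v ->
  {morph @weighted_comp R X F a v : f g / f + g}.
Proof.
move=> sF aF ma wv f g; have [_ _ [M vM]] := wv.
have WE h := (weighted_compP h sF aF ma wv vM).1.
apply: bfs_fun_inj; apply/funext => x.
by rewrite raddfD /= WE raddfD fctE /= mulrDr -!WE.
Qed.

Lemma weighted_comp_cancel a b v v' : cancel b a ->
  solid F -> comp_invariant F a -> comp_invariant F b ->
  borel_measurable a -> borel_measurable b -> weight v -> weight v' ->
  (forall x, v' x * v (b x) = 1) ->
  cancel (@weighted_comp R X F a v) (weighted_comp b v').
Proof.
move=> bK sF aF bF ma mb wv wv' vv' f.
have [_ _ [M vM]] := wv; have [_ _ [M' vM']] := wv'.
have WE h := (weighted_compP h sF aF ma wv vM).1.
have WE' h := (weighted_compP h sF bF mb wv' vM').1.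
apply: bfs_fun_inj; apply/funext => x.
by rewrite WE' WE bK mulrA -rmorphM vv' mul1r.
Qed.

(* Composing [iter n (weighted_comp a v) f] with the norm-preserving
   [iter n b] moves the support back to that of [f]. *)
Lemma nrm_iter_weighted_comp a b v f n : cancel b a ->
  solid F -> comp_invariant F a -> comp_invariant F b ->
  borel_measurable a -> weight v ->
  exists2 g : F, (forall x, bfs_fun g x =
      (\prod_(0 <= s < n) v (iter s.+1 b x))%:C * bfs_fun f x) &
    nrm g = nrm (iter n (weighted_comp a v) f).
Proof.
move=> bK sF aF bF ma wv; have [_ _ [M vM]] := wv.
have WE h := (weighted_compP h sF aF ma wv vM).1.
set W := weighted_comp a v.
have [g gE gn] : exists2 g : F, bfs_fun g = bfs_fun (iter n W f) \o iter n b &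
    nrm g = nrm (iter n W f).
  (* The induction is on the number of compositions with [b] alone, for an arbitrary vector. *)
  elim: (n) (iter n W f) => [|k IH] h; first by exists h.
  have [g gE gn] := bF h; have [g' gE' gn'] := IH g.
  exists g'; first by rewrite gE' gE.
  by rewrite gn' /nrm gn.
exists g => // x; rewrite gE /= {g gE gn}; elim: n => [|n IH] /=.
  by rewrite big_geq// mul1r.
by rewrite WE bK IH mulrA -rmorphM; congr (_%:C * _); rewrite big_nat_recr//= mulrC.
Qed.

Lemma borel_measurable_indic (D : set X) :
  borel D -> borel_measurable (\1_D : X -> R).
Proof.
move=> mD B _; rewrite preimage_indic.
have b0 : borel (set0 : set X) by exact: sigma_algebra0.
by do 2 case: ifP => _ //; [rewrite -setC0; exact: borelC|exact: borelC].
Qed.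

Lemma bfs_restrict f (D : set X) : solid F -> borel D ->
  exists g : F, forall x, bfs_fun g x = (\1_D x)%:C * bfs_fun f x.
Proof.
move=> sF mD; have [||g gE _] := sF f (fun x => (\1_D x)%:C * bfs_fun f x).
- exact: borel_measurable_realM (borel_measurable_indic mD) (bfs_fun_measurable f).
- move=> x; rewrite normrM indicE; case: (_ \in _); last by rewrite normr0 mul0r.
  by rewrite normr1 mul1r.
- by exists g => x; rewrite gE.
Qed.

(** Once the support is moved back, the bound [M] on [D] and solidity conclude. The product enters
    through [p], so that either series of the theorem can be matched. *)
Lemma nrm_iter_weighted_comp_le a b v f n M (D : set X) (p : X -> R) :
  cancel b a ->
  solid F -> comp_invariant F a -> comp_invariant F b ->
  borel_measurable a -> weight v -> 0 < M ->
  (forall x, `|bfs_fun f x| <= M%:C * \1_D x) ->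
  (forall x, p x = \prod_(0 <= s < n) v (iter s.+1 b x)) ->
  ((nrm (iter n (weighted_comp a v) f))%:E <=
    M%:E * fnorm F (fun x => \1_D x * (p x)%:C)%R)%E.
Proof.
move=> bK sF aF bF ma wv M0 fM pE.
have [g gE <-] := nrm_iter_weighted_comp f n bK sF aF bF ma wv.
apply: solid_fnorm => // x; rewrite gE !normrM [leLHS]mulrC mulrA -pE ler_wpM2r//.
by apply: le_trans (fM x) _; rewrite indicE; case: (_ \in _); rewrite ?normr1 ?normr0.
Qed.

End WeightedComposition.

(** * From the extended-real series of the hypothesis to chaos *)

Lemma sum_le_of_nneseries (R : realType) (u : nat -> R) (t : nat -> \bar R) (M e : R) :
  0 < M -> (forall l, (0 <= t l)%E) -> (forall l, ((u l)%:E <= M%:E * t l)%E) ->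
  (\sum_(1 <= l <oo) t l < (e / M)%:E)%E ->
  forall m, \sum_(0 <= l < m) u l.+1 <= e.
Proof.
move=> M0 t0 ut te m; rewrite -lee_fin -sumEFin.
apply: (@le_trans _ _ (M%:E * \sum_(1 <= l <oo) t l)%E).
  rewrite -nneseriesZl//.
  (* The series starts at 1 and the real sum at [u 1], so [m] real terms match the series cut at
     [m.+1]. *)
  apply: le_trans (nneseries_lim_ge m.+1 _) => [|l _ _]; last first.
    by apply: mule_ge0 => //; rewrite lee_fin ltW.
  by rewrite big_add1 /=; exact: lee_sum.
by rewrite -lee_pdivlMl// -EFinM mulrC ltW.
Qed.

Lemma cvg_ereal_lt (R : realType) (t : nat -> \bar R) (e : R) :
  t k @[k --> \oo] --> 0%E -> 0 < e -> \forall k \near \oo, (t k < e%:E)%E.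
Proof.
move=> t0 e0; have := t0 [set y | (y < e%:E)%E]; apply.
by apply: open_ereal_lt'; rewrite lte_fin.
Qed.

Theorem corollary3p8 (R : realType) (X : topologicalType)
  (alpha alphainv : X -> X)
  (alphaK : cancel alpha alphainv) (alphainvK : cancel alphainv alpha)
  (malpha : borel_measurable alpha) (malphainv : borel_measurable alphainv)
  (F : banach_function_space R X) (Omega : condition_Omega F alpha alphainv)
  (w : X -> R) (weight_w : weight w) (weight_winv : weight (fun x => (w x)^-1))
  (hyp : forall K : set X, compact K ->
    exists (D : nat -> set X) (n : nat -> nat),
      [/\ forall k, borel (D k) /\ D k `<=` K,
          forall k, (0 < n k)%N,
          {homo n : i j / (i < j)%N},
          fnorm F \1_(K `\` D k) @[k --> \oo] --> 0%E
        & let S1 k := (\sum_(1 <= l <oo)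
              fnorm F (fun x => (\1_(D k) x *
                (\prod_(1 <= s < (l * n k).+1) w (iter s alphainv x))%:C)%R))%E in
          let S2 k := (\sum_(1 <= l <oo)
              fnorm F (fun x => (\1_(D k) x *
                ((\prod_(0 <= s < l * n k) w (iter s alpha x))^-1)%:C)%R))%E in
          [/\ forall k, (S1 k < +oo)%E /\ (S2 k < +oo)%E,
              S1 k @[k --> \oo] --> 0%E & S2 k @[k --> \oo] --> 0%E]]) :
  chaotic (C_op F alpha alphainv w).
Proof.
have [sF aF bF indF dense_bc] := Omega.
(* This weight makes [S_op] a weighted composition with [alphainv]; its bound is that of 1/w. *)
pose vS x := (w (alphainv x))^-1.
have weight_vS : weight vS.
  have [mwi wi0 [M wiM]] := weight_winv; split.
  - exact: borel_measurable_comp mwi malphainv.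
  - by move=> x; exact: wi0.
  - by exists M => x; exact: wiM.
have [_ w0 [CT wCT]] := weight_w; have [_ _ [CS wCS]] := weight_vS.
pose T := T_op alpha w : F -> F; pose S := S_op alphainv w : F -> F.
(* A bound on a weight may be negative if [X] is empty; truncation at 0 gives the nonnegative
   constants that the cosine lemmas take. *)
pose absC (c : R) := Num.max c 0.
have TD : {morph T : f g / f + g} by exact: weighted_compD.
have SD : {morph S : f g / f + g} by exact: weighted_compD.
have bound (W : F -> F) c : (forall f, nrm (W f) <= c * nrm f) ->
    forall f, nrm (W f) <= absC c * nrm f.
  by move=> Wc f; apply: le_trans (Wc f) _; rewrite ler_wpM2r ?nrm_ge0// le_max lexx.
have absC0 c : 0 <= absC c by rewrite le_max lexx orbT.
have Tb := bound T CT (fun f => (weighted_compP f sF aF malpha weight_w wCT).2).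
have Sb := bound S CS (fun f => (weighted_compP f sF bF malphainv weight_vS wCS).2).
have TK : cancel T S.
  apply: weighted_comp_cancel => // x; exact/mulVf/lt0r_neq0.
have SK : cancel S T.
  by apply: weighted_comp_cancel => // x; rewrite /vS alphaK; exact/mulfV/lt0r_neq0.
have approx f g : bounded_compact_support f -> bounded_compact_support g ->
    forall e, 0 < e -> exists2 n, (0 < n)%N & exists f' g',
      [/\ nrm (f - f') <= e, nrm (g - g') <= e,
          orbit_sums_le T S n e f' & orbit_sums_le T S n e g'].
  move=> [[Mf fM] cf] [[Mg gM] cg] e e0.
  (* One compact set containing both supports yields a common cut [D k] and a common power [n k]. *)
  pose K := closure [set x | bfs_fun f x != 0] `|` closure [set x | bfs_fun g x != 0].
  have cK : compact K by exact: compactU.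
  (* A common bound for both functions; the 1 makes it positive, so that [e / M] is a valid
     threshold. *)
  pose M := Num.max 1 (Num.max Mf Mg).
  have M0 : 0 < M by rewrite lt_max ltr01.
  have [D [n [mD n0 _ KD [_ S1 S2]]]] := hyp K cK.
  have eM : 0 < e / M by rewrite divr_gt0.
  have [k _ /(_ k (leqnn k)) /= [KDk [S1k S2k]]] := filterI (cvg_ereal_lt KD eM)
    (filterI (cvg_ereal_lt S1 eM) (cvg_ereal_lt S2 eM)).
  exists (n k) => //.
  have cut h : (forall x, `|bfs_fun h x| <= M%:C) -> (forall x, ~ K x -> bfs_fun h x = 0) ->
      exists h', nrm (h - h') <= e /\ orbit_sums_le T S (n k) e h'.
    move=> hM hK; have [h' h'E] := bfs_restrict h sF (mD k).1.
    have h'M x : `|bfs_fun h' x| <= M%:C * \1_(D k) x.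
      rewrite h'E normrM !indicE; case: (_ \in _); last by rewrite normr0 mul0r mulr0.
      by rewrite normr1 mul1r mulr1.
    exists h'; split.
      (* The error [h - h'] vanishes off [K] minus [D k] and is bounded by [M] there. *)
      rewrite -lee_fin; apply: le_trans (solid_fnorm (h := \1_(K `\` D k)) sF M0 _) _.
        move=> x; have -> : bfs_fun (h - h') x = bfs_fun h x - bfs_fun h' x by rewrite raddfB.
        rewrite h'E.
        have [Dx|nDx] := pselect (D k x).
          by rewrite (indicE R) (mem_set Dx) mul1r subrr normr0 mulr_ge0// lecR ltW.
        rewrite (indicE R) memNset// mul0r subr0.
        have [Kx|nKx] := pselect (K x); last by rewrite hK// normr0 mulr_ge0// lecR ltW.
        by rewrite indicE mem_set//= normr1 mulr1.
      by rewrite -lee_pdivlMl// -EFinM mulrC ltW.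
    split.
      apply: (sum_le_of_nneseries (u := fun l => nrm (iter (l * n k) T h')) M0 _ _ S1k) => l.
        exact: fnorm_ge0.
      (* The factors are w at alpha^-(s+1) x for s from 0, reindexed to start at 1. *)
      apply: (nrm_iter_weighted_comp_le alphainvK) => // x.
      by rewrite big_add1.
    apply: (sum_le_of_nneseries (u := fun l => nrm (iter (l * n k) S h')) M0 _ _ S2k) => l.
      exact: fnorm_ge0.
    (* The weight of [S] at alpha^(s+1) x is the inverse of w at alpha^s x, hence a product starting
       at s = 0. *)
    apply: (nrm_iter_weighted_comp_le alphaK) => // x.
    by rewrite -prodfV; apply: eq_bigr => s _; rewrite /= alphaK.
  have offK (h : F) : closure [set x | bfs_fun h x != 0] `<=` K ->
      forall x, ~ K x -> bfs_fun h x = 0.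
    move=> hK x Kx; apply: contrapT => /eqP hx; apply: Kx; apply: hK.
    exact: subset_closure.
  have MM (c : R) (z : R[i]) : c <= M -> `|z| <= c%:C -> `|z| <= M%:C.
    by move=> cM zc; apply: le_trans zc _; rewrite lecR.
  have [f' [ff' Sf']] : exists f', nrm (f - f') <= e /\ orbit_sums_le T S (n k) e f'.
    apply: cut; last by apply: offK => x; left.
    by move=> x; apply: MM (fM x); rewrite !le_max lexx orbT.
  have [g' [gg' Sg']] : exists g', nrm (g - g') <= e /\ orbit_sums_le T S (n k) e g'.
    apply: cut; last by apply: offK => x; right.
    by move=> x; apply: MM (gM x); rewrite !le_max lexx !orbT.
  by exists f', g'.
split.
- exact: cosine_transitive approx.
- exact: cosine_dense_periodic approx.
Qed.
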